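(* There is no cascade of equal-frequency transitions with more than three levels: for every integer $m\ge 3$, there do not exist positive integers $x_0<x_1<\cdots<x_m$ such that $$\frac{1}{x_{0}^2}-\frac{1}{x_1^2}=\frac{1}{x_1^2}-\frac{1}{x_2^2}=\cdots=\frac{1}{x_{m-1}^2}-\frac{1}{x_m^2}.$$
   Context: In the Bohr model of hydrogen the energy levels are proportional to $-1/n^2$, with $n$ a positive integer. A cascade of equal-frequency transitions with $m+1$ levels is a sequence of positive integers $x_0<x_1<\cdots<x_m$ for which the differences $\frac{1}{x_{i-1}^2}-\frac{1}{x_{i}^2}$, $1\le i\le m$, are all equal. *)

(* Defs.v *)
From HB Require Import structures.
From mathcomp Require Import all_boot all_order all_algebra.

Set Implicit Arguments.
Unset Strict Implicit.
Unset Printing Implicit Defensive.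

Import Order.TTheory GRing.Theory Num.Theory.

Local Open Scope ring_scope.

(* Up to a common physical constant, the frequency of the transition between
   the levels a and b (a < b) of the Bohr model. *)
Definition transition_freq (a b : nat) : rat :=
  1 / (a%:R ^+ 2) - 1 / (b%:R ^+ 2).

(* The m + 1 levels x_0, ..., x_m are the entries of x.  With indices starting
   at 0, the i-th of the m transitions (i < m) joins x_i and x_(i+1); the
   default value of nth is never used. *)
Definition equal_freq_cascade (m : nat) (x : m.+1.-tuple nat) : Prop :=
  [/\ forall i : nat, (i <= m)%N -> (0 < nth 0%N x i)%N,
      forall i : nat, (i < m)%N -> (nth 0%N x i < nth 0%N x i.+1)%N
    & forall i j : nat, (i < m)%N -> (j < m)%N ->
        transition_freq (nth 0%N x i) (nth 0%N x i.+1) =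
        transition_freq (nth 0%N x j) (nth 0%N x j.+1)].

(* Main.v *)
Require Import Defs.
From mathcomp Require Import all_boot all_order all_algebra.
From mathcomp Require Import zify ring lra.

Set Implicit Arguments.
Unset Strict Implicit.
Unset Printing Implicit Defensive.

Import Order.TTheory GRing.Theory Num.Theory.

(** Clearing denominators, four consecutive levels give squares a^2, b^2, c^2,
    d^2 in arithmetic progression (Fermat). With e = c^2 - b^2, the numbers
    x = 2abcd and y = (b^2 + c^2) e make both x^2 + y^2 and x^2 + 4y^2 squares:
    this is the 2-isogeny from t(t - 1)(t - 9) = u^2 to t(t + 4)(t + 16) = v^2
    evaluated at t = ((b^2 + c^2) / e)^2.

    Such x, y > 0 are excluded by descent. One may take x, y coprime; if x is
    even then (y, x/2) is a smaller pair. If x is odd, parametrizing both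
    Pythagorean triples gives x = m^2 - n^2 = M^2 - N^2 and y = 2mn = MN, say
    with N even. Factoring M (N/2) = mn as m = ac, n = bd, N/2 = ab, M = cd
    turns the first equation into d^2 (c^2 + b^2) = a^2 (c^2 + 4 b^2). By
    coprimality c^2 + b^2 = k a^2 and c^2 + 4 b^2 = k d^2 with k | 3, and k = 3
    is impossible modulo 3, so (c, b) is a smaller pair. *)

(** The square of [gcdn a c] is the gcd of a^2, ac and c^2 = ab. Pulling out the factor a leaves
    gcd(a, b, c) = 1. *)
Lemma coprime_mul_sqr (a b c : nat) :
  coprime a b -> a * b = c ^ 2 -> a = gcdn a c ^ 2.
Proof.
move=> cab abc; apply/esym.
transitivity (gcdn (gcdn (a * a) (a * c)) (gcdn (a * b) (a * c))).
  by rewrite abc -!mulnn muln_gcdl !muln_gcdr (mulnC c a) [gcdn (c * c) _]gcdnC.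
by rewrite -!muln_gcdr gcdnACA (eqP cab) gcd1n muln1.
Qed.

(** Take p = gcd(a, c): the cofactors q = a/p and r = c/p are coprime and qb = rd, so q divides
    d. *)
Lemma four_numbers (a b c d : nat) : 0 < a -> a * b = c * d ->
  exists p q r s, [/\ a = p * q, b = r * s, c = p * r & d = q * s].
Proof.
move=> a_gt0 abcd; have p_gt0 : 0 < gcdn a c by rewrite gcdn_gt0 a_gt0.
have /dvdnP[q Ea] := dvdn_gcdl a c; have /dvdnP[r Ec] := dvdn_gcdr a c.
have cqr : coprime q r.
  rewrite /coprime -(eqn_pmul2r p_gt0) mul1n; apply/eqP.
  by rewrite muln_gcdl -Ea -Ec.
set p := gcdn a c in p_gt0 Ea Ec.
have qbrd : q * b = r * d.
  by apply/eqP; rewrite -(eqn_pmul2l p_gt0) !mulnA ![p * _]mulnC -Ea -Ec abcd.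
have /dvdnP[s Ed] : q %| d by rewrite -(Gauss_dvdr _ cqr) -qbrd dvdn_mulr.
have q_gt0 : 0 < q by move: a_gt0; rewrite Ea muln_gt0 => /andP[].
exists p, q, r, s; split; rewrite ?[p * _]mulnC // 1?mulnC //.
by apply/eqP; rewrite -(eqn_pmul2l q_gt0) qbrd Ed; apply/eqP; ring.
Qed.

(** With z = x + 2A and y = 2h the equation becomes A (A + x) = h^2. The two factors are coprime,
    hence are squares n^2 and m^2. *)
Lemma pythagorean_param (x y z : nat) :
  coprime x y -> odd x -> ~~ odd y -> x ^ 2 + y ^ 2 = z ^ 2 ->
  exists m n, [/\ coprime m n, m ^ 2 = x + n ^ 2 & y = 2 * (m * n)].
Proof.
move=> cxy ox ey Ez.
have oz : odd z by have := congr1 odd Ez; rewrite oddD !oddX ox (negPf ey).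
have lexz : x <= z by rewrite -leq_sqr -Ez leq_addr.
have [A EA] : exists A, z = x + 2 * A by exists ((z - x)./2); lia.
have [h Eh] : exists h, y = 2 * h by exists y./2; lia.
have Ah : A * (A + x) = h ^ 2 by move: Ez; rewrite EA Eh; nia.
have cAx : coprime A (A + x).
  rewrite coprime_sym -coprime_modl modnDl coprime_modl.
  apply: (@coprime_dvdr _ (h ^ 2)); first by rewrite -Ah dvdn_mulr.
  by rewrite coprimeXr //; apply: coprime_dvdr cxy; rewrite Eh dvdn_mull.
have EA2 := coprime_mul_sqr cAx Ah.
have EB2 : A + x = gcdn (A + x) h ^ 2.
  by apply: (@coprime_mul_sqr _ A); rewrite 1?coprime_sym // mulnC.
exists (gcdn (A + x) h), (gcdn A h); split.
- by rewrite -(@coprime_pexpl 2) // -(@coprime_pexpr 2) // -EA2 -EB2 coprime_sym.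
- by rewrite -EA2 -EB2 addnC.
rewrite Eh; congr (2 * _); apply/eqP; rewrite -(@eqn_exp2r _ _ 2) //.
by rewrite expnMn -EA2 -EB2 mulnC Ah.
Qed.

Lemma coprime_sum_sqr_dvd3 (x y : nat) :
  coprime x y -> ~~ (3 %| x ^ 2 + y ^ 2).
Proof.
move=> cxy; apply/negP => d3.
have [d3x d3y] : 3 %| x /\ 3 %| y.
  rewrite /dvdn -modnDm -(modnXm 2 3 x) -(modnXm 2 3 y) in d3 *.
  have := ltn_pmod x (isT : 0 < 3); have := ltn_pmod y (isT : 0 < 3).
  by case: (x %% 3) d3 => [|[|[|?]]] //; case: (y %% 3) => [|[|[|?]]].
by have := dvdn_gcd 3 x y; rewrite d3x d3y (eqP cxy).
Qed.

(** Euler's concordant forms x^2 + M y^2 and x^2 + N y^2, for the coefficients 1 and 4. *)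
Definition concordant (x y : nat) :=
  (exists z, x ^ 2 + y ^ 2 = z ^ 2) /\ (exists w, x ^ 2 + 4 * y ^ 2 = w ^ 2).

Lemma concordant_of_proportion (a b c d : nat) :
  0 < a -> coprime a d -> coprime c b ->
  d ^ 2 * (c ^ 2 + b ^ 2) = a ^ 2 * (c ^ 2 + 4 * b ^ 2) -> concordant c b.
Proof.
move=> a_gt0 cad ccb E.
have /dvdnP[k Ek] : a ^ 2 %| c ^ 2 + b ^ 2.
  rewrite -(@Gauss_dvdr _ (d ^ 2)); last by rewrite coprimeXl // coprimeXr.
  by rewrite E dvdn_mulr.
have Ek4 : c ^ 2 + 4 * b ^ 2 = k * d ^ 2.
  apply/eqP; rewrite -(@eqn_pmul2l (a ^ 2)) ?expn_gt0 ?a_gt0 // -E Ek.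
  by apply/eqP; ring.
have k3c : k %| 3 * c ^ 2.
  have -> : 3 * c ^ 2 = 4 * (c ^ 2 + b ^ 2) - (c ^ 2 + 4 * b ^ 2) by lia.
  by rewrite Ek Ek4 mulnCA; apply: dvdn_sub; rewrite dvdn_mulr.
have k3b : k %| 3 * b ^ 2.
  have -> : 3 * b ^ 2 = (c ^ 2 + 4 * b ^ 2) - (c ^ 2 + b ^ 2) by lia.
  by rewrite Ek Ek4; apply: dvdn_sub; rewrite dvdn_mulr.
have k3 : k %| 3.
  have c22 : coprime (c ^ 2) (b ^ 2) by rewrite coprimeXl // coprimeXr.
  by have := dvdn_gcd k (3 * c ^ 2) (3 * b ^ 2);
    rewrite k3c k3b -muln_gcdr (eqP c22) muln1.
have k1 : k = 1.
  have := coprime_sum_sqr_dvd3 ccb; rewrite Ek.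
  by move: k3 (dvdn_leq (isT : 0 < 3) k3); case: (k) => [|[|[|[|?]]]] // _ _; rewrite dvdn_mulr.
by split; [exists a; rewrite Ek k1 mul1n | exists d; rewrite Ek4 k1 mul1n].
Qed.

Lemma concordant_coprime_reduce (x y : nat) : 0 < x -> 0 < y ->
  concordant x y ->
  exists u v, [/\ coprime u v, 0 < u, 0 < v, u * v <= x * y & concordant u v].
Proof.
move=> x_gt0 y_gt0 [[z Ez] [w Ew]].
have g_gt0 : 0 < gcdn x y by rewrite gcdn_gt0 x_gt0.
have /dvdnP[u Eu] := dvdn_gcdl x y; have /dvdnP[v Ev] := dvdn_gcdr x y.
have cuv : coprime u v.
  rewrite /coprime -(eqn_pmul2r g_gt0) mul1n; apply/eqP.
  by rewrite muln_gcdl -Eu -Ev.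
set g := gcdn x y in g_gt0 Eu Ev.
(* Used with n = 1 and n = 4, one for each form: g^2 divides k^2, so g divides k. *)
have dvg n k : (u ^ 2 + n * v ^ 2) * g ^ 2 = k ^ 2 ->
    exists l, u ^ 2 + n * v ^ 2 = l ^ 2.
  move=> E; have /dvdnP[l El] : g %| k by rewrite -(@dvdn_pexp2r _ _ 2) // -E dvdn_mull.
  exists l; apply/eqP; rewrite -(@eqn_pmul2r (g ^ 2)) ?expn_gt0 ?g_gt0 //.
  by rewrite E El expnMn.
exists u, v; split=> //.
- by move: x_gt0; rewrite Eu muln_gt0 => /andP[].
- by move: y_gt0; rewrite Ev muln_gt0 => /andP[].
- by rewrite Eu Ev mulnACA leq_pmulr // muln_gt0 g_gt0.
split.
  have [|l El] := dvg 1 z; first by rewrite -Ez Eu Ev; ring.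
  by exists l; rewrite -El mul1n.
by apply: (dvg 4 w); rewrite -Ew Eu Ev; ring.
Qed.

Lemma concordant_descent (x y : nat) : 0 < x -> 0 < y -> coprime x y ->
  concordant x y ->
  exists u v, [/\ 0 < u, 0 < v, u * v < x * y & concordant u v].
Proof.
move=> x_gt0 y_gt0 cxy [[z Ez] [w Ew]].
have [ox|ex] := boolP (odd x); last first.
  have [x' Ex] : exists x', x = 2 * x' by exists x./2; lia.
  have ew : ~~ odd w by have := congr1 odd Ew; rewrite oddD oddM !oddX (negPf ex) /= => <-.
  have [w' Ew'] : exists w', w = 2 * w' by exists w./2; lia.
  (* The two forms exchange roles: y^2 + x'^2 = (w/2)^2 and y^2 + 4 x'^2 = z^2. *)
  exists y, x'; split; try nia.
  split; [exists w' | exists z; rewrite -Ez Ex; ring].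
  by move: Ew; rewrite Ex Ew'; nia.
(* Two odd squares add up to 2 modulo 4, which is not a square. *)
have ey : ~~ odd y.
  apply/negP => oy; have /andP[] : (odd x) && (odd y) by rewrite ox.
  have: (x ^ 2 + y ^ 2) %% 4 = z ^ 2 %% 4 by rewrite Ez.
  rewrite -modnDm -(modnXm 2 4 x) -(modnXm 2 4 y) -(modnXm 2 4 z).
  have [ox4 oy4] : odd (x %% 4) /\ odd (y %% 4) by rewrite !odd_mod.
  have := ltn_pmod x (isT : 0 < 4); have := ltn_pmod y (isT : 0 < 4).
  have := ltn_pmod z (isT : 0 < 4).
  case: (x %% 4) ox4 => [|[|[|[|?]]]] //; case: (y %% 4) oy4 => [|[|[|[|?]]]] //;
  by case: (z %% 4) => [|[|[|[|?]]]].
have [m [n [cmn Emn Ey]]] := pythagorean_param cxy ox ey Ez.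
have cx2y : coprime x (2 * y) by rewrite coprimeMr cxy andbT coprimen2.
have [M [N [cMN EMN E2y]]] : exists M N,
    [/\ coprime M N, M ^ 2 = x + N ^ 2 & 2 * y = 2 * (M * N)].
  apply: (@pythagorean_param _ _ w) => //; first by rewrite oddM.
  by rewrite -Ew expnMn.
have mnMN : M * N = 2 * (m * n) by lia.
have mn_gt0 : 0 < m * n by lia.
(* Both parity cases end here. The new pair is smaller since c b <= m n < 2 m n = y <= x y. *)
have descent a b c d : m * n = a * c * (b * d) -> coprime (a * c) (b * d) ->
    d ^ 2 * (c ^ 2 + b ^ 2) = a ^ 2 * (c ^ 2 + 4 * b ^ 2) ->
    exists u v, [/\ 0 < u, 0 < v, u * v < x * y & concordant u v].
  move=> Eabcd cop E.
  have /andP[/andP[a_gt0 c_gt0] /andP[b_gt0 d_gt0]] :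
    ((0 < a) && (0 < c)) && ((0 < b) && (0 < d)).
    by rewrite -!muln_gt0 -Eabcd.
  move: cop; rewrite coprimeMl !coprimeMr => /andP[/andP[_ cad] /andP[ccb _]].
  exists c, b; split=> //; last exact: concordant_of_proportion E.
  have: c * b <= m * n by rewrite Eabcd (mulnC a) mulnACA leq_pmulr // muln_gt0 a_gt0.
  have: y <= x * y by rewrite leq_pmull.
  by lia.
have [eN|oN] := boolP (odd N); last first.
  have [N' EN] : exists N', N = 2 * N' by exists N./2; lia.
  have E : N' * M = m * n by lia.
  have N'_gt0 : 0 < N' by move: mn_gt0; rewrite -E muln_gt0 => /andP[].
  have [a [b [c [d [Ea Eb Ec Ed]]]]] := four_numbers N'_gt0 E.
  apply: (descent a b c d); rewrite -?Ec -?Ed //.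
  by move: Emn EMN; rewrite EN Ea Eb Ec Ed !expnMn; lia.
(* Now M is even. Swapping m with n as well as M with N changes the sign of both sides of m^2 - n^2
   = M^2 - N^2, so the same relation between a, b, c, d results. *)
have [M' EM] : exists M', M = 2 * M'.
  by exists M./2; have := congr1 odd mnMN; rewrite !oddM eN /=; lia.
have E : M' * N = n * m by lia.
have M'_gt0 : 0 < M' by move: mn_gt0; rewrite mulnC -E muln_gt0 => /andP[].
have [a [b [c [d [Ea Eb Ec Ed]]]]] := four_numbers M'_gt0 E.
apply: (descent a b c d); rewrite -?Ec -?Ed 1?mulnC // 1?coprime_sym //.
by move: Emn EMN; rewrite EM Ea Eb Ec Ed !expnMn; lia.
Qed.

Lemma not_concordant (x y : nat) : 0 < x -> 0 < y -> ~ concordant x y.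
Proof.
have [n] := ubnP (x * y); elim: n x y => // n IHn x y lexy x_gt0 y_gt0 Cxy.
have [u [v [cuv u_gt0 v_gt0 leuv Cuv]]] := concordant_coprime_reduce x_gt0 y_gt0 Cxy.
have [s [t [s_gt0 t_gt0 ltst]]] := concordant_descent u_gt0 v_gt0 cuv Cuv.
by apply: IHn => //; lia.
Qed.

Lemma no_four_squares_in_AP (a b c d : nat) :
  0 < a -> 0 < b -> 0 < c -> 0 < d -> b < c ->
  2 * b ^ 2 = a ^ 2 + c ^ 2 -> 2 * c ^ 2 = b ^ 2 + d ^ 2 -> False.
Proof.
move=> a_gt0 b_gt0 c_gt0 d_gt0 ltbc E1 E2.
have [e Ec] : exists e, c ^ 2 = b ^ 2 + e by exists (c ^ 2 - b ^ 2); nia.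
have e_gt0 : 0 < e by move: ltbc; rewrite -ltn_sqr Ec; lia.
have Eb : b ^ 2 = a ^ 2 + e by lia.
have Ed : d ^ 2 = a ^ 2 + 3 * e by lia.
have {}Ec : c ^ 2 = a ^ 2 + 2 * e by lia.
apply: (@not_concordant (2 * (a * b * c * d)) ((2 * a ^ 2 + 3 * e) * e)).
- by rewrite !muln_gt0 a_gt0 b_gt0 c_gt0.
- by rewrite muln_gt0 e_gt0 addn_gt0 !muln_gt0 e_gt0 orbT.
(* Put S = a^2 d^2 = a^2 (a^2 + 3e). Then b^2 c^2 = S + 2 e^2 and (b^2 + c^2)^2 = 4S + 9 e^2, so the
   two forms are the squares of 2S + 3 e^2 and 2S + 6 e^2. *)
split; [exists (2 * a ^ 4 + 6 * (a ^ 2 * e) + 3 * e ^ 2)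
       | exists (2 * a ^ 4 + 6 * (a ^ 2 * e) + 6 * e ^ 2)];
  by rewrite (expnMn 2) !(expnMn _ d, expnMn _ c, expnMn _ b) Eb Ec Ed; ring.
Qed.

(** This is 2/q^2 = 1/p^2 + 1/r^2 multiplied by (p q r s)^2. Including s gives both triples of
    consecutive levels the same multiplier. *)
Lemma transition_freq_eq (p q r s : nat) :
  0 < p -> 0 < q -> 0 < r -> 0 < s ->
  transition_freq p q = transition_freq q r ->
  2 * (p * r * s) ^ 2 = (q * r * s) ^ 2 + (p * q * s) ^ 2.
Proof.
move=> p_gt0 q_gt0 r_gt0 s_gt0; rewrite /transition_freq => E.
apply/eqP; rewrite -(eqr_nat rat) natrD (natrM _ 2) !natrX !natrM; apply/eqP.
have p0 : (p%:R != 0 :> rat)%R by rewrite pnatr_eq0 -lt0n.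
have q0 : (q%:R != 0 :> rat)%R by rewrite pnatr_eq0 -lt0n.
have r0 : (r%:R != 0 :> rat)%R by rewrite pnatr_eq0 -lt0n.
move: p0 q0 r0 E; move: (p%:R)%R (q%:R)%R (r%:R)%R (s%:R)%R => P Q R S P0 Q0 R0 E.
have {}E : (2 * (1 / Q ^+ 2) = 1 / P ^+ 2 + 1 / R ^+ 2)%R by lra.
have -> : (2 * (P * R * S) ^+ 2 = 2 * (1 / Q ^+ 2) * (P * Q * R * S) ^+ 2)%R.
  by field.
by rewrite E; field; rewrite P0 R0.
Qed.

Theorem mainTheorem3 (m : nat) (hm : (3 <= m)%N) :
  ~ exists x : m.+1.-tuple nat, equal_freq_cascade x.
Proof.
case=> x [x_gt0 x_lt x_freq].
have x0 := x_gt0 0 (leq0n m); have x1 := x_gt0 1 (ltnW (ltnW hm)).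
have x2 := x_gt0 2 (ltnW hm); have x3 := x_gt0 3 hm.
have lt12 := x_lt 1 (ltnW hm).
have E1 := transition_freq_eq x0 x1 x2 x3 (x_freq 0 1 (ltnW (ltnW hm)) (ltnW hm)).
have E2 := transition_freq_eq x1 x2 x3 x0 (x_freq 1 2 (ltnW hm) hm).
move: (nth 0 x 0) (nth 0 x 1) (nth 0 x 2) (nth 0 x 3) x0 x1 x2 x3 lt12 E1 E2.
move=> p q r s p0 q0 r0 s0 ltqr E1 E2.
(* These are p q r s divided by each level, from the last level to the first, so that they
   increase. *)
apply: (@no_four_squares_in_AP (p * q * r) (p * q * s) (p * r * s) (q * r * s)).
all: rewrite ?muln_gt0 ?p0 ?q0 ?r0 ?s0 //.
- by rewrite ltn_pmul2r // ltn_pmul2l.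
- by move: E2; rewrite (mulnC (q * s)) (mulnC (r * s)) (mulnC (q * r)) !mulnA addnC.
- by rewrite E1 addnC.
Qed.
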